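(* Let $k\geq2$ and $\alpha\geq2$ be integers. The decision problem ''Given a $k$-regular sequence $(f(n))_{n\geq0}$, does $(f(n))_{n\geq0}$ contain an $\alpha$-power?'' is recursively unsolvable.
   Context: For $n\in\mathbb{N}_0$, $(n)_k=n_{s-1}\cdots n_0$ is the standard base-$k$ representation of $n$ (no leading zeros; $(0)_k$ empty). A sequence $(f(n))_{n\geq0}$ is $k$-regular if there exist $r\geq0$, a $1\times r$ row vector $v$, an $r\times1$ column vector $w$ and $r\times r$ matrices $M_0,\dots,M_{k-1}$ such that $f(n)=vM_{n_0}\cdots M_{n_{s-1}}w$ for all $n$; the input is such a linear representation. An $\alpha$-power in $(f(n))$ is a nonempty contiguous block $(f(j))_{i\leq j<i+\alpha m}$, for some $i\geq0$ and $m\geq1$, such that $f(i+t)=f(i+sm+t)$ for all $0\leq s<\alpha$ and $0\leq t<m$. *)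

(* Defs.v *)
From mathcomp Require Import all_boot all_order all_algebra.
Set Implicit Arguments. Unset Strict Implicit. Unset Printing Implicit Defensive.
Import GRing.Theory Num.Theory.

Inductive recf : Type :=
  | RZero : recf
  | RSucc : recf
  | RProj : nat -> recf
  | RComp : recf -> list recf -> recf
  | RPrim : recf -> recf -> recf
  | RMu   : recf -> recf.

Inductive eval : recf -> seq nat -> nat -> Prop :=
  | ev_zero xs : eval RZero xs 0
  | ev_succ xs : eval RSucc xs (head 0%N xs).+1
  | ev_proj i xs : eval (RProj i) xs (nth 0%N xs i)
  | ev_comp f gs xs ys y :
      evals gs xs ys -> eval f ys y -> eval (RComp f gs) xs y
  | ev_prim0 f g rest y :
      eval f rest y -> eval (RPrim f g) (0%N :: rest) y
  | ev_primS f g n rest y z :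
      eval (RPrim f g) (n :: rest) y -> eval g (n :: y :: rest) z ->
      eval (RPrim f g) (n.+1 :: rest) z
  | ev_mu f xs y :
      eval f (y :: xs) 0 ->
      (forall y', (y' < y)%N -> exists z, eval f (y' :: xs) z.+1) ->
      eval (RMu f) xs y
with evals : list recf -> seq nat -> seq nat -> Prop :=
  | evs_nil xs : evals nil xs [::]
  | evs_cons g gs xs y ys :
      eval g xs y -> evals gs xs ys -> evals (g :: gs) xs (y :: ys).

Definition npair (a b : nat) : nat := (((a + b) * (a + b).+1) %/ 2 + b)%N.

Definition enc_int (z : int) : nat :=
  match z with Posz n => (2 * n)%N | Negz n => (2 * n).+1 end.

Fixpoint enc_list (l : seq nat) : nat :=
  match l with [::] => 0%N | x :: l' => (npair x (enc_list l')).+1 end.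

Definition enc_ints (l : seq int) : nat := enc_list (map enc_int l).
Definition enc_mat (M : seq (seq int)) : nat := enc_list (map enc_ints M).

Record linrep := LinRep {
  lr_dim : nat;
  lr_v : seq int;
  lr_w : seq int;
  lr_M : seq (seq (seq int))          (* M_0, ..., M_{k-1}, each r x r, rows *)
}.

Definition enc_linrep (L : linrep) : nat :=
  enc_list [:: lr_dim L; enc_ints (lr_v L); enc_ints (lr_w L);
               enc_list (map enc_mat (lr_M L))].

Definition linrep_wf (k : nat) (L : linrep) : bool :=
  [&& size (lr_v L) == lr_dim L, size (lr_w L) == lr_dim L,
      size (lr_M L) == k &
      all (fun M => (size M == lr_dim L) && all (fun row => size row == lr_dim L) M)
          (lr_M L)].

Fixpoint digits_aux (k fuel n : nat) : seq nat :=
  match fuel with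
  | 0 => [::]
  | fuel'.+1 => if n == 0%N then [::] else (n %% k)%N :: digits_aux k fuel' (n %/ k)
  end.

(* least significant digit first: [:: n_0; n_1; ...; n_{s-1}];
   empty for n = 0 (k >= 2 makes the fuel n sufficient) *)
Definition digits (k n : nat) : seq nat := digits_aux k n n.

Local Open Scope ring_scope.

Definition lr_row (L : linrep) : 'rV[int]_(lr_dim L) :=
  \row_(j < lr_dim L) nth 0 (lr_v L) j.
Definition lr_col (L : linrep) : 'cV[int]_(lr_dim L) :=
  \col_(i < lr_dim L) nth 0 (lr_w L) i.
Definition lr_mat (L : linrep) (d : nat) : 'M[int]_(lr_dim L) :=
  \matrix_(i < lr_dim L, j < lr_dim L) nth 0 (nth [::] (nth [::] (lr_M L) d) i) j.

Definition lr_seq (k : nat) (L : linrep) (n : nat) : int :=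
  (lr_row L *m foldr (fun d P => lr_mat L d *m P) 1%:M (digits k n) *m lr_col L)
    ord0 ord0.

Definition has_power (f : nat -> int) (alpha : nat) : Prop :=
  exists i m : nat, (1 <= m)%N /\
    forall s t : nat, (s < alpha)%N -> (t < m)%N -> f (i + t)%N = f (i + s * m + t)%N.

(* Main.v *)
Require Import Defs.
From mathcomp Require Import all_boot all_order all_algebra.
From mathcomp Require Import zify ring.
Set Implicit Arguments. Unset Strict Implicit. Unset Printing Implicit Defensive.
Import GRing.Theory Num.Theory.

(** A recursive function is compiled into a program with nondeterministic loops
over registers whose only operations are zeroing, increment, copy and the test
that two registers are equal; every search is replaced by a guess followed by
tests. The base-k digits of n, read from the least significant one, resolve the
guesses. Summing the squares of the failing differences, plus 1 if the run does
not halt, gives a nonnegative k-regular sequence c(n): each step is affine in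
the registers, so the cost is a quadratic form in the initial registers whose
coefficients satisfy linear recurrences along the digits. It vanishes at some n
iff the function takes the value 0 on the initial registers.

The program ignores its first alpha digits, so c is constant on blocks of length
k^alpha. Let f(n) = s(n) (n + 1) c(n), where s(n) is -1 if k divides n and 1
otherwise. A zero of c yields a block of k^alpha >= alpha zeros of f, whereas f
has no square if c is positive.

The input enters only the initial row vector of the representation of f, so a
representation can be given the code of all its other parts and, using
multiplication and pairing, compute its own code. Applied to a decision
procedure for alpha-powers, this yields a sequence that has an alpha-power iff
the procedure answers 0 on it. *)

(** * Induction on recursive functions and determinism of evaluation *)

(** The generated principle gives no hypothesis for the functions in the list of [RComp]. *)
Lemma recf_nested_ind (P : recf -> Prop) :
  P RZero -> P RSucc -> (forall i, P (RProj i)) ->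
  (forall f gs, P f -> (forall i, i < size gs -> P (nth RZero gs i)) ->
     P (RComp f gs)) ->
  (forall f g, P f -> P g -> P (RPrim f g)) ->
  (forall f, P f -> P (RMu f)) -> forall f, P f.
Proof.
move=> P0 PS Pproj Pcomp Pprim Pmu; fix IH 1; case=> [||i|f gs|f g|f].
- exact: P0.
- exact: PS.
- exact: Pproj.
- apply: Pcomp; first exact: IH.
  elim: gs => [|g gs IHgs] i; first (rewrite ltn0; discriminate).
  by case: i => [_|i /IHgs] /=; [exact: IH | apply].
- by apply: Pprim; exact: IH.
- by apply: Pmu; exact: IH.
Qed.

Lemma eval_functional f xs y z : eval f xs y -> eval f xs z -> y = z.
Proof.
elim/recf_nested_ind: f xs y z => [||i|f gs IHf IHgs|f g IHf IHg|f IHf] xs y z Hy Hz.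
- by inversion Hy; inversion Hz.
- by inversion Hy; inversion Hz.
- by inversion Hy; inversion Hz.
- inversion Hy as [| | |? ? ? ys1 ? E1 F1| | |]; subst.
  inversion Hz as [| | |? ? ? ys2 ? E2 F2| | |]; subst.
  suff E : ys1 = ys2 by subst ys2; exact: IHf F1 F2.
  clear -IHgs E1 E2; elim: gs ys1 ys2 IHgs E1 E2 => [|g gs IH] ys1 ys2 IHgs E1 E2.
    by inversion E1; inversion E2.
  inversion E1 as [|? ? ? y1 l1 G1 L1]; subst.
  inversion E2 as [|? ? ? y2 l2 G2 L2]; subst.
  congr cons; first exact: (IHgs 0) G1 G2.
  by apply: IH L1 L2 => i; exact: (IHgs i.+1).
- case: xs Hy Hz => [|n xs] Hy Hz; first by inversion Hy.
  elim: n y z Hy Hz => [|n IHn] y z Hy Hz.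
    inversion Hy; inversion Hz; subst; eapply IHf; eassumption.
  inversion Hy as [| | | | |? ? ? ? y1 ? A1 B1|]; subst.
  inversion Hz as [| | | | |? ? ? ? y2 ? A2 B2|]; subst.
  have E := IHn _ _ A1 A2; subst y2; exact: IHg B1 B2.
- inversion Hy as [| | | | | |? ? ? A1 B1]; subst.
  inversion Hz as [| | | | | |? ? ? A2 B2]; subst.
  (* At the smaller of two results [f] would be 0, and positive by the clause of the larger one. *)
  case: (ltngtP y z) => // lt.
  + have [u Hu] := B2 _ lt; by have := IHf _ _ _ A1 Hu.
  + have [u Hu] := B1 _ lt; by have := IHf _ _ _ A2 Hu.
Qed.

(** * Nondeterministic register programs and the compiler *)

Definition env := nat -> nat.
Definition set_reg (rho : env) (r v : nat) : env :=
  fun x => if x == r then v else rho x.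

Inductive cmd :=
  | CZero of nat
  | CInc of nat
  | CCopy of nat & nat
  | CTest of nat & nat
  | CSeq of cmd & cmd
  | CLoop of cmd.

Inductive exec : cmd -> env -> env -> Prop :=
  | ex_zero r rho : exec (CZero r) rho (set_reg rho r 0)
  | ex_inc r rho : exec (CInc r) rho (set_reg rho r (rho r).+1)
  | ex_copy r s rho : exec (CCopy r s) rho (set_reg rho r (rho s))
  | ex_test r s rho : rho r = rho s -> exec (CTest r s) rho rho
  | ex_seq c1 c2 rho1 rho2 rho3 :
      exec c1 rho1 rho2 -> exec c2 rho2 rho3 -> exec (CSeq c1 c2) rho1 rho3
  | ex_loop0 c rho : exec (CLoop c) rho rho
  | ex_loopS c rho1 rho2 rho3 :
      exec c rho1 rho2 -> exec (CLoop c) rho2 rho3 -> exec (CLoop c) rho1 rho3.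

Lemma exec_seqE c1 c2 rho rho' : exec (CSeq c1 c2) rho rho' ->
  exists2 rho1, exec c1 rho rho1 & exec c2 rho1 rho'.
Proof. by move=> H; inversion H; subst; exists rho2. Qed.

Lemma exec_zeroE r rho rho' : exec (CZero r) rho rho' -> rho' = set_reg rho r 0.
Proof. by move=> H; inversion H. Qed.
Lemma exec_incE r rho rho' :
  exec (CInc r) rho rho' -> rho' = set_reg rho r (rho r).+1.
Proof. by move=> H; inversion H. Qed.
Lemma exec_copyE r s rho rho' :
  exec (CCopy r s) rho rho' -> rho' = set_reg rho r (rho s).
Proof. by move=> H; inversion H. Qed.
Lemma exec_testE r s rho rho' :
  exec (CTest r s) rho rho' -> rho' = rho /\ rho r = rho s.
Proof. by move=> H; inversion H; subst. Qed.

Lemma exec_loop_inv (I : env -> Prop) c rho rho' :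
  (forall r1 r2, I r1 -> exec c r1 r2 -> I r2) ->
  exec (CLoop c) rho rho' -> I rho -> I rho'.
Proof.
move=> inv; move E : (CLoop c) => lc H; elim: H E => //.
move=> c' rho1 rho2 rho3 H1 _ _ IH [Ec] I1; subst c'.
by apply: IH => //; exact: inv H1.
Qed.

Definition CLoad (n : nat) (args : seq nat) (i : nat) : cmd :=
  if i < size args then CCopy n (nth 0 args i) else CZero n.

(* [compile f args n] evaluates [f] on the registers [args], leaves the value in register [n] and modifies no register below [n]; the number of iterations of every loop is guessed, and checked afterwards. *)
Fixpoint compile (f : recf) (args : seq nat) (n : nat) : cmd :=
  match f with
  | RZero => CZero n
  | RSucc => CSeq (CLoad n args 0) (CInc n)
  | RProj i => CLoad n args i
  | RComp f gs =>
      CSeq ((fix compiles gs m := match gs with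
             | [::] => CTest 0 0
             | g :: gs' => CSeq (compile g args m) (compiles gs' m.+1)
             end) gs n)
        (CSeq (compile f (iota n (size gs)) (n + size gs)) (CCopy n (n + size gs)))
  | RPrim f g =>
      match args with
      | [::] => CSeq (CZero n) (CSeq (CZero n.+1) (CSeq (CInc n.+1) (CTest n n.+1)))
      | a :: rest =>
          CSeq (compile f rest n) (CSeq (CZero n.+1)
            (CSeq (CLoop (CSeq (compile g (n.+1 :: n :: rest) n.+2)
                           (CSeq (CCopy n n.+2) (CInc n.+1))))
               (CTest n.+1 a)))
      end
  | RMu f =>
      CSeq (CZero n)
        (CSeq (CLoop (CSeq (compile f (n :: args) n.+1)
                       (CSeq (CZero n.+2) (CSeq (CLoop (CInc n.+2))
                         (CSeq (CInc n.+2) (CSeq (CTest n.+1 n.+2) (CInc n)))))))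
           (CSeq (compile f (n :: args) n.+1)
              (CSeq (CZero n.+2) (CTest n.+1 n.+2))))
  end.

Fixpoint compiles (gs : seq recf) (args : seq nat) (m : nat) : cmd :=
  match gs with
  | [::] => CTest 0 0
  | g :: gs' => CSeq (compile g args m) (compiles gs' args m.+1)
  end.

Lemma compile_RComp f gs args n : compile (RComp f gs) args n =
  CSeq (compiles gs args n)
    (CSeq (compile f (iota n (size gs)) (n + size gs)) (CCopy n (n + size gs))).
Proof.
rewrite /=; congr CSeq; by elim: gs n => //= g gs IH m; congr CSeq.
Qed.

Lemma set_reg_eq rho r v : set_reg rho r v r = v.
Proof. by rewrite /set_reg eqxx. Qed.
Lemma set_reg_neq rho r v x : x != r -> set_reg rho r v x = rho x.
Proof. by rewrite /set_reg => /negPf ->. Qed.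

Ltac simpl_reg := repeat first
  [ rewrite set_reg_eq
  | match goal with
    | |- context [set_reg ?rho ?r ?v ?x] =>
        rewrite (@set_reg_neq rho r v x); last by lia
    end ].

Definition agree_below (n : nat) (rho rho' : env) := forall r, r < n -> rho' r = rho r.

Lemma agree_trans n rho1 rho2 rho3 :
  agree_below n rho1 rho2 -> agree_below n rho2 rho3 -> agree_below n rho1 rho3.
Proof. by move=> H1 H2 r lt; rewrite H2 ?H1. Qed.

Lemma agree_weak m n rho rho' : n <= m ->
  agree_below m rho rho' -> agree_below n rho rho'.
Proof. by move=> le H r lt; apply: H; exact: leq_trans le. Qed.

Lemma agree_set n rho r v : n <= r -> agree_below n rho (set_reg rho r v).
Proof. by move=> le x lt; rewrite set_reg_neq // neq_ltn (leq_trans lt le). Qed.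

Lemma agree_map n rho rho' args : all (gtn n) args -> agree_below n rho rho' ->
  map rho' args = map rho args.
Proof. by move=> /allP H A; apply/eq_in_map => a /H /= /A. Qed.

Lemma all_gtn_weak m n args : n <= m -> all (gtn n) args -> all (gtn m) args.
Proof. by move=> le /allP H; apply/allP => a /H /= lt; exact: leq_trans le. Qed.

Lemma all_gtn_iota n m : all (gtn (n + m)) (iota n m).
Proof. by apply/allP => x; rewrite mem_iota => /andP[]. Qed.

Lemma exec_load n args i rho :
  exists2 rho', exec (CLoad n args i) rho rho' &
    rho' n = nth 0 (map rho args) i /\ agree_below n rho rho'.
Proof.
rewrite /CLoad; case: ltnP => lt.
  exists (set_reg rho n (rho (nth 0 args i))); first exact: ex_copy.
  by rewrite set_reg_eq (nth_map 0) //; split=> //; exact: agree_set.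
exists (set_reg rho n 0); first exact: ex_zero.
by rewrite set_reg_eq nth_default ?size_map //; split=> //; exact: agree_set.
Qed.

Lemma exec_loadE n args i rho rho' : exec (CLoad n args i) rho rho' ->
  rho' n = nth 0 (map rho args) i /\ agree_below n rho rho'.
Proof.
rewrite /CLoad; case: ltnP => lt.
  move/exec_copyE=> ->.
  by rewrite set_reg_eq (nth_map 0) //; split=> //; exact: agree_set.
move/exec_zeroE=> ->.
by rewrite set_reg_eq nth_default ?size_map //; split=> //; exact: agree_set.
Qed.

(** The frame belongs to the induction hypothesis: arguments and intermediate values lie below the
    register where a subprogram starts to write, and must survive it. *)
Definition compile_sound_for f := forall args n rho rho', all (gtn n) args ->
  exec (compile f args n) rho rho' ->
  eval f (map rho args) (rho' n) /\ agree_below n rho rho'.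

Lemma compiles_sound gs args m rho rho' :
  (forall i, i < size gs -> compile_sound_for (nth RZero gs i)) ->
  all (gtn m) args -> exec (compiles gs args m) rho rho' ->
  evals gs (map rho args) (map rho' (iota m (size gs))) /\ agree_below m rho rho'.
Proof.
elim: gs m rho => [|g gs IH] m rho Hgs Hargs /=.
  by move/exec_testE=> [-> _]; split=> //; exact: evs_nil.
case/exec_seqE=> rho1 H1 H2.
have [E1 A1] := Hgs 0 isT _ _ _ _ Hargs H1.
have [|E2 A2] := IH m.+1 rho1 (fun i => Hgs i.+1) _ H2.
  exact: all_gtn_weak Hargs.
split; last by apply: agree_trans A1 (agree_weak _ A2).
apply: evs_cons; first by rewrite (A2 m).
by rewrite -(agree_map Hargs A1).
Qed.

Lemma compile_sound f : compile_sound_for f.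
Proof.
elim/recf_nested_ind: f => [||i|f gs IHf IHgs|f g IHf IHg|f IHf] args n rho rho' Hargs.
- move/exec_zeroE=> ->; rewrite set_reg_eq; split; first exact: ev_zero.
  exact: agree_set.
- case/exec_seqE=> rho1 /exec_loadE[E1 A1] /exec_incE ->.
  rewrite set_reg_eq E1 nth0; split; first exact: ev_succ.
  by apply: agree_trans A1 _; exact: agree_set.
- by case/exec_loadE=> -> A1; split=> //; exact: ev_proj.
- rewrite compile_RComp => /exec_seqE[rho1 /(compiles_sound IHgs Hargs)[E1 A1]].
  case/exec_seqE=> rho2 /IHf[|E2 A2 /exec_copyE ->]; first exact: all_gtn_iota.
  rewrite set_reg_eq; split; first exact: ev_comp E1 E2.
  apply: agree_trans A1 (agree_trans (agree_weak _ A2) (agree_set _ _ _)) => //.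
  exact: leq_addr.
- case: args Hargs => [|a rest] Hargs /=.
    (* [RPrim] has no value on the empty list; its code then compares 0 with 1 and cannot
       succeed. *)
    case/exec_seqE=> rho1 /exec_zeroE -> /exec_seqE[rho2 /exec_zeroE -> ].
    case/exec_seqE=> rho3 /exec_incE -> /exec_testE[_].
    by rewrite set_reg_eq /set_reg eqxx ?(ltn_eqF (ltnSn n)) /= ?(ltn_eqF (ltnSn n)) eqxx.
  have /andP[lta Hrest] : (a < n) && all (gtn n) rest := Hargs.
  case/exec_seqE=> rho1 /(IHf _ _ _ _ Hrest)[E1 A1].
  case/exec_seqE=> rho2 /exec_zeroE -> /exec_seqE[rho3 H3 /exec_testE[-> T]].
  (* Register [n.+1] counts the iterations and [n] holds the value reached; the final test compares
     the count with [a]. *)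
  pose I (s : env) :=
    eval (RPrim f g) (s n.+1 :: map rho rest) (s n) /\ agree_below n rho s.
  have : I rho3.
    apply: (exec_loop_inv _ H3).
      move=> s1 s2 [Ev Ag] /exec_seqE[s3 Hg].
      have [|Ev3 Ag3] := IHg _ _ _ _ _ Hg.
        by rewrite /= (all_gtn_weak _ Hrest) ?andbT; lia.
      case/exec_seqE=> s4 /exec_copyE -> /exec_incE ->.
      split.
        simpl_reg; rewrite (Ag3 n.+1) //; apply: ev_primS Ev _.
        by rewrite /= (agree_map Hrest Ag) in Ev3.
      apply: agree_trans Ag _; apply: agree_trans (agree_weak _ Ag3) _; first by lia.
      by apply: agree_trans (agree_set _ _ _) (agree_set _ _ _).
    split; last by apply: agree_trans A1 (agree_set _ _ _).
    simpl_reg; exact: ev_prim0.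
  case=> Ev Ag; split=> //=.
  by rewrite -(Ag a lta) -T.
- have Hn : all (gtn n.+1) (n :: args) by rewrite /= ltnSn; exact: all_gtn_weak Hargs.
  case/exec_seqE=> rho1 /exec_zeroE -> /exec_seqE[rho2 H2].
  case/exec_seqE=> rho3 /(IHf _ _ _ _ Hn)[E3 A3].
  case/exec_seqE=> rho4 /exec_zeroE -> /exec_testE[-> T].
  (* Each iteration checks that a value is positive by guessing its predecessor in [n.+2]. *)
  pose I (s : env) :=
    (forall y, y < s n -> exists z, eval f (y :: map rho args) z.+1) /\ agree_below n rho s.
  have : I rho2.
    apply: (exec_loop_inv _ H2); last first.
      by split; [rewrite set_reg_eq | exact: agree_set].
    move=> s1 s2 [Ev Ag] /exec_seqE[s3 /(IHf _ _ _ _ Hn)[Ev3 Ag3]].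
    case/exec_seqE=> s4 /exec_zeroE -> /exec_seqE[s5 H5 /exec_seqE[s6 /exec_incE ->]].
    case/exec_seqE=> s7 /exec_testE[-> T7] /exec_incE ->.
    have A5 : agree_below n.+2 s3 s5.
      apply: (@exec_loop_inv (agree_below n.+2 s3) _ _ _ _ H5); last exact: agree_set.
      by move=> t1 t2 At /exec_incE ->; exact: agree_trans At (agree_set _ _ _).
    split; last first.
      apply: agree_trans Ag _; apply: agree_trans (agree_weak _ Ag3) _ => //.
      apply: agree_trans (agree_weak _ A5) _; first by lia.
      by apply: agree_trans (agree_set _ _ _) (agree_set _ _ _); lia.
    move=> y; simpl_reg; rewrite (A5 n) // (Ag3 n) // ltnS leq_eqVlt => /orP[/eqP->|]; last exact: Ev.
    exists (s5 n.+2); move: T7; simpl_reg; rewrite (A5 n.+1) // => <-.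
    by rewrite /= (agree_map Hargs Ag) in Ev3.
  case=> Ev Ag.
  have T' : rho3 n.+1 = 0.
    by move: T; simpl_reg.
  split.
    simpl_reg; rewrite (A3 n) //; apply: ev_mu => //.
    by rewrite /= (agree_map Hargs Ag) T' in E3.
  apply: agree_trans Ag _; apply: agree_trans (agree_weak _ A3) (agree_set _ _ _) => //.
  by lia.
Qed.

Lemma exec_loop_rcons c rho1 rho2 rho3 :
  exec (CLoop c) rho1 rho2 -> exec c rho2 rho3 -> exec (CLoop c) rho1 rho3.
Proof.
move E : (CLoop c) => lc H; elim: H E => //.
  by move=> c' rho [Ec] H; subst c'; exact: ex_loopS H (ex_loop0 _ _).
move=> c' r1 r2 r3 H1 _ _ IH [Ec] H3; subst c'.
by apply: ex_loopS H1 _; exact: IH.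
Qed.

Lemma exec_loop_inc r rho v : exists2 rho', exec (CLoop (CInc r)) rho rho' &
  rho' r = rho r + v /\ forall x, x != r -> rho' x = rho x.
Proof.
elim: v => [|v [s H [E A]]]; first by exists rho; [exact: ex_loop0 | rewrite addn0].
exists (set_reg s r (s r).+1); first exact: exec_loop_rcons H (ex_inc _ _).
by split=> [|x ne]; simpl_reg; [rewrite E addnS | exact: A].
Qed.

Definition compile_complete_for f := forall args n rho y, all (gtn n) args ->
  eval f (map rho args) y ->
  exists2 rho', exec (compile f args n) rho rho' & rho' n = y /\ agree_below n rho rho'.

(* The value and the frame come for free from soundness and determinism. *)
Lemma compile_complete_forW f :
  (forall args n rho y, all (gtn n) args -> eval f (map rho args) y ->
     exists rho', exec (compile f args n) rho rho') -> compile_complete_for f.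
Proof.
move=> H args n rho y Hargs E; have [rho' X] := H _ _ _ _ Hargs E.
have [E' A'] := compile_sound Hargs X.
by exists rho' => //; split=> //; exact: eval_functional E' E.
Qed.

Lemma compiles_complete gs args m rho ys :
  (forall i, i < size gs -> compile_complete_for (nth RZero gs i)) ->
  all (gtn m) args -> evals gs (map rho args) ys ->
  exists2 rho', exec (compiles gs args m) rho rho' & map rho' (iota m (size gs)) = ys.
Proof.
elim: gs m rho ys => [|g gs IH] m rho ys Hgs Hargs Hev.
  by inversion Hev; subst; exists rho => //; exact: ex_test.
inversion Hev as [|? ? ? y1 l1 G1 L1]; subst.
have [rho1 X1 [E1 A1]] := Hgs 0 isT _ _ _ _ Hargs G1.
have Hargs' := all_gtn_weak (leqnSn m) Hargs.
have L1' : evals gs (map rho1 args) l1 by rewrite (agree_map Hargs A1).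
have [rho2 X2 E2] := IH m.+1 rho1 l1 (fun i => Hgs i.+1) Hargs' L1'.
exists rho2; first exact: ex_seq X1 X2.
have [_ A2] := compiles_sound (fun i _ => @compile_sound _) Hargs' X2.
by rewrite /= (A2 m) // E1 E2.
Qed.

Lemma compile_complete f : compile_complete_for f.
Proof.
elim/recf_nested_ind: f => [||i|f gs IHf IHgs|f g IHf IHg|f IHf];
  apply: compile_complete_forW => args n rho y Hargs Hev.
- by exists (set_reg rho n 0); exact: ex_zero.
- have [rho1 X1 _] := exec_load n args 0 rho.
  by exists (set_reg rho1 n (rho1 n).+1); apply: ex_seq X1 (ex_inc _ _).
- by have [rho1 X1 _] := exec_load n args i rho; exists rho1.
- inversion Hev as [| | |? ? ? ys ? E1 F1| | |]; subst.
  have [rho1 X1 E] := compiles_complete IHgs Hargs E1; subst ys.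
  have [rho2 X2 _] := IHf _ _ _ _ (all_gtn_iota n (size gs)) F1.
  exists (set_reg rho2 n (rho2 (n + size gs))); rewrite compile_RComp.
  by apply: ex_seq X1 (ex_seq X2 (ex_copy _ _ _)).
- case: args Hargs Hev => [|a rest] Hargs Hev; first by inversion Hev.
  have /andP[lta Hrest] : (a < n) && all (gtn n) rest := Hargs.
  set body := CSeq (compile g (n.+1 :: n :: rest) n.+2)
                   (CSeq (CCopy n n.+2) (CInc n.+1)).
  have loop i : forall z, eval (RPrim f g) (i :: map rho rest) z ->
      exists rho1 s, [/\ exec (compile f rest n) rho rho1,
        exec (CLoop body) (set_reg rho1 n.+1 0) s,
        s n.+1 = i, s n = z & agree_below n rho s].
    elim: i => [|i IHi] z Hz.
      inversion Hz as [| | | |? ? ? ? F| |]; subst.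
      have [rho1 X1 [E1 A1]] := IHf _ _ _ _ Hrest F.
      exists rho1, (set_reg rho1 n.+1 0); split=> //; simpl_reg => //.
        exact: ex_loop0.
      exact: agree_trans A1 (agree_set _ _ _).
    inversion Hz as [| | | | |? ? ? ? z1 ? F G|]; subst.
    have [rho1 [s [X1 X2 E1 E2 As]]] := IHi _ F.
    have G' : eval g (map s (n.+1 :: n :: rest)) z.
      by rewrite /= E1 E2 (agree_map Hrest As).
    have [|s1 Y1 [E3 A3]] := IHg _ n.+2 _ _ _ G'.
      by rewrite /= (all_gtn_weak _ Hrest) ?andbT; lia.
    set s2 := set_reg s1 n (s1 n.+2).
    exists rho1, (set_reg s2 n.+1 (s2 n.+1).+1); split=> //.
    + apply: exec_loop_rcons X2 _; apply: ex_seq Y1 _.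
      by apply: ex_seq (ex_copy _ _ _) (ex_inc _ _).
    + by rewrite /s2; simpl_reg; rewrite (A3 n.+1) // E1.
    + by rewrite /s2; simpl_reg; rewrite E3.
    + apply: agree_trans As _; apply: agree_trans (agree_weak _ A3) _; first by lia.
      by apply: agree_trans (agree_set _ _ _) (agree_set _ _ _).
  have [rho1 [s [X1 X2 E1 E2 As]]] := loop _ _ Hev.
  exists s; apply: ex_seq X1 _; apply: ex_seq (ex_zero _ _) _.
  by apply: ex_seq X2 (ex_test _); rewrite E1 (As a).
- have Hn : all (gtn n.+1) (n :: args) by rewrite /= ltnSn; exact: all_gtn_weak Hargs.
  inversion Hev as [| | | | | |? ? ? A1 B1]; subst.
  set body := CSeq (compile f (n :: args) n.+1)
                (CSeq (CZero n.+2) (CSeq (CLoop (CInc n.+2))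
                  (CSeq (CInc n.+2) (CSeq (CTest n.+1 n.+2) (CInc n))))).
  have loop i : i <= y -> exists s, [/\ exec (CLoop body) (set_reg rho n 0) s,
      s n = i & agree_below n rho s].
    elim: i => [|i IHi] le.
      exists (set_reg rho n 0); split; [exact: ex_loop0|by simpl_reg|exact: agree_set].
    have [s [X1 E As]] := IHi (ltnW le); have [v Hv] := B1 _ le.
    have Hv' : eval f (map s (n :: args)) v.+1 by rewrite /= E (agree_map Hargs As).
    have [s1 X2 [E2 A2]] := IHf _ _ _ _ Hn Hv'.
    (* The right guess is [v], the predecessor of the value at [i]. *)
    have [s2 X3 [E3 A3]] := exec_loop_inc n.+2 (set_reg s1 n.+2 0) v.
    set s3 := set_reg s2 n.+2 (s2 n.+2).+1.
    exists (set_reg s3 n (s3 n).+1); split.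
    + apply: exec_loop_rcons X1 _; apply: ex_seq X2 _.
      apply: ex_seq (ex_zero _ _) (ex_seq X3 (ex_seq (ex_inc _ _) _)).
      apply: ex_seq (ex_test _) (ex_inc _ _); simpl_reg.
      by rewrite A3 ?E3; simpl_reg; rewrite ?E2 //; lia.
    + rewrite /s3; simpl_reg; rewrite A3; last by lia.
      by simpl_reg; rewrite (A2 n) // E.
    + move=> r lt; rewrite /s3; simpl_reg; rewrite A3; last by lia.
      by simpl_reg; rewrite (A2 r) ?As //; lia.
  have [s [X1 E As]] := loop y (leqnn y).
  have A1' : eval f (map s (n :: args)) 0 by rewrite /= E (agree_map Hargs As).
  have [s1 X2 [E2 A2]] := IHf _ _ _ _ Hn A1'.
  exists (set_reg s1 n.+2 0); apply: ex_seq (ex_zero _ _) (ex_seq X1 (ex_seq X2 _)).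
  by apply: ex_seq (ex_zero _ _) (ex_test _); simpl_reg.
Qed.

(** * Flat programs driven by a word, and their cost *)

Inductive instr :=
  | IZero of nat
  | IInc of nat
  | ICopy of nat & nat
  | ITest of nat & nat
  | IFork of nat
  | IBack of nat.

(** Jumps are relative, so code may stand anywhere in a program. The fork of a loop exits on letter
    0 and enters the body on any other letter. *)
Fixpoint flat (c : cmd) : seq instr :=
  match c with
  | CZero r => [:: IZero r]
  | CInc r => [:: IInc r]
  | CCopy r s => [:: ICopy r s]
  | CTest r s => [:: ITest r s]
  | CSeq c1 c2 => flat c1 ++ flat c2
  | CLoop c => IFork (size (flat c)).+2 :: flat c ++ [:: IBack (size (flat c)).+1]
  end.

(* The default [IBack 0] makes the address just after the program a halting state. *)
Definition instr_at (P : seq instr) (pc : nat) : instr := nth (IBack 0) P pc.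

Definition jump (i : instr) (pc d : nat) : nat :=
  match i with
  | IFork l => if d == 0 then pc + l else pc.+1
  | IBack l => pc - l
  | _ => pc.+1
  end.

(** The cap at [size P] keeps the addresses in a finite range, so that they can index matrices. *)
Definition next_pc (P : seq instr) (pc d : nat) : nat :=
  minn (size P) (jump (instr_at P pc) pc d).

Definition act (i : instr) (rho : env) : env :=
  match i with
  | IZero r => set_reg rho r 0
  | IInc r => set_reg rho r (rho r).+1
  | ICopy r s => set_reg rho r (rho s)
  | _ => rho
  end.

Definition defect (i : instr) (rho : env) : int :=
  match i with
  | ITest r s => ((Posz (rho r) - Posz (rho s)) ^+ 2)%R
  | _ => 0%R
  end.

(* The word [w] drives the forks; [cost] vanishes iff all tests succeed along [w] and the run ends in the halting state. *)
Fixpoint cost (P : seq instr) (pc : nat) (rho : env) (w : seq nat) : int :=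
  match w with
  | [::] => Posz (pc != size P)
  | d :: w' =>
      (defect (instr_at P pc) rho +
       cost P (next_pc P pc d) (act (instr_at P pc) rho) w')%R
  end.

Lemma defect_ge0 i rho : (0 <= defect i rho)%R.
Proof. by case: i => //= r s; exact: sqr_ge0. Qed.

Lemma cost_ge0 P pc rho w : (0 <= cost P pc rho w)%R.
Proof.
elim: w pc rho => [|d w IH] pc rho //=.
by rewrite addr_ge0 ?defect_ge0.
Qed.

Lemma cost_cons_eq0 P pc rho d w : cost P pc rho (d :: w) = 0%R ->
  defect (instr_at P pc) rho = 0%R /\
  cost P (next_pc P pc d) (act (instr_at P pc) rho) w = 0%R.
Proof.
move=> /= /eqP; rewrite paddr_eq0 ?defect_ge0 ?cost_ge0 //.
by case/andP=> /eqP-> /eqP->.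
Qed.

Lemma instr_at_cat A i B : instr_at (A ++ i :: B) (size A) = i.
Proof. by rewrite /instr_at nth_cat ltnn subnn. Qed.

Lemma cost_halt P rho w : cost P (size P) rho w = 0%R.
Proof.
elim: w rho => [|d w IH] rho /=; first by rewrite eqxx.
have -> : instr_at P (size P) = IBack 0 by rewrite /instr_at nth_default.
rewrite /= add0r; suff -> : next_pc P (size P) d = size P by [].
by rewrite /next_pc /instr_at nth_default //= subn0 minnn.
Qed.

Lemma next_pc_cat A i B d : jump i (size A) d <= size A + (size B).+1 ->
  next_pc (A ++ i :: B) (size A) d = jump i (size A) d.
Proof. by move=> le; rewrite /next_pc instr_at_cat; apply/minn_idPr; rewrite size_cat. Qed.

Lemma cost_cat_eq0 A i B rho w : cost (A ++ i :: B) (size A) rho w = 0%R ->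
  exists d w', [/\ w = d :: w', defect i rho = 0%R &
    cost (A ++ i :: B) (next_pc (A ++ i :: B) (size A) d) (act i rho) w' = 0%R].
Proof.
case: w => [|d w]; last first.
  by case/cost_cons_eq0; rewrite instr_at_cat => H1 H2; exists d, w.
(* The empty word at an address below [size P] costs 1. *)
move=> /= [] /eqP; rewrite size_cat /= eqb0 negbK; lia.
Qed.

(** Costs are sums of nonnegative terms, so zero cost means that every test passes and the run
    cannot stop inside the code. The bound on [size v] serves the loop case, an induction on the
    length of the word: every iteration consumes letters. *)
Lemma flat_sound c P A B rho w : P = A ++ flat c ++ B ->
  cost P (size A) rho w = 0%R ->
  exists rho' v, [/\ size v <= size w, exec c rho rho' &
    cost P (size A + size (flat c)) rho' v = 0%R].
Proof.
elim: c P A B rho w => [r|r|r s|r s|c1 IH1 c2 IH2|c IH] P A B rho w -> /=.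
- case/cost_cat_eq0=> d [v [-> _]]; rewrite next_pc_cat /=; last by lia.
  by rewrite -addn1 => C; exists (set_reg rho r 0), v; split=> //; exact: ex_zero.
- case/cost_cat_eq0=> d [v [-> _]]; rewrite next_pc_cat /=; last by lia.
  by rewrite -addn1 => C; exists (set_reg rho r (rho r).+1), v; split=> //; exact: ex_inc.
- case/cost_cat_eq0=> d [v [-> _]]; rewrite next_pc_cat /=; last by lia.
  by rewrite -addn1 => C; exists (set_reg rho r (rho s)), v; split=> //; exact: ex_copy.
- case/cost_cat_eq0=> d [v [-> /eqP]]; rewrite sqrf_eq0 subr_eq0 => /eqP[E].
  rewrite next_pc_cat /=; last by lia.
  by rewrite -addn1 => C; exists rho, v; split=> //; exact: ex_test.
- rewrite -!catA => C.
  have [r1 [v1 [le1 X1 C1]]] := IH1 _ _ _ _ _ erefl C.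
  rewrite -size_cat catA in C1.
  have [r2 [v2 [le2 X2 C2]]] := IH2 _ _ _ _ _ erefl C1.
  exists r2, v2; split; first exact: leq_trans le1.
    exact: ex_seq X1 X2.
  by rewrite -catA size_cat -addnA -size_cat in C2.
- set sz := size (flat c); set P' := A ++ _.
  have [n le] := ubnP (size w); elim: n => // n IHn in rho w le *.
  case/cost_cat_eq0=> d [v [Ew _]] /=; rewrite next_pc_cat /=; last first.
    by case: ifP => _; rewrite ?size_cat /= ?size_cat /=; lia.
  case: ifP => _ C.
    exists rho, v; split; [by rewrite Ew /= | exact: ex_loop0 |].
    by rewrite size_cat /= addn1.
  have EP : P' = rcons A (IFork sz.+2) ++ flat c ++ (IBack sz.+1 :: B).
    by rewrite /P' -cats1 -!catA.
  rewrite -/P' -(size_rcons A (IFork sz.+2)) in C.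
  have [r1 [v1 [le1 X1 C1]]] := IH _ _ _ _ _ EP C.
  rewrite EP catA -size_cat in C1.
  case/cost_cat_eq0: C1 => d2 [v2 [E2 _]]; rewrite next_pc_cat /=; last by lia.
  rewrite -catA -EP size_cat size_rcons -/sz.
  have -> : (size A).+1 + sz - sz.+1 = size A by lia.
  move=> C2; have [|r2 [v3 [le3 X2 C3]]] := IHn _ _ _ C2.
    by move: le le1; rewrite Ew E2 /=; lia.
  exists r2, v3; split=> //; last exact: ex_loopS X1 X2.
  by move: le1 le3; rewrite Ew E2 /=; lia.
Qed.

(** The letters 0 and 1 suffice for the forks and are digits in every base [k >= 2]. Since [w] is
    arbitrary, runs compose by concatenation. *)
Lemma flat_complete c rho rho' : exec c rho rho' ->
  forall P A B, P = A ++ flat c ++ B -> exists2 u, all (gtn 2) u &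
    forall w, cost P (size A) rho (u ++ w) = cost P (size A + size (flat c)) rho' w.
Proof.
elim=> {c rho rho'} [r rho|r rho|r s rho|r s rho E|c1 c2 r1 r2 r3 _ IH1 _ IH2
  |c rho|c r1 r2 r3 _ IH1 _ IH2] P A B -> /=.
- by exists [:: 0] => // w /=; rewrite instr_at_cat next_pc_cat /= ?add0r ?addn1 //; lia.
- by exists [:: 0] => // w /=; rewrite instr_at_cat next_pc_cat /= ?add0r ?addn1 //; lia.
- by exists [:: 0] => // w /=; rewrite instr_at_cat next_pc_cat /= ?add0r ?addn1 //; lia.
- exists [:: 0] => // w /=; rewrite instr_at_cat next_pc_cat /=; last by lia.
  by rewrite E subrr expr0n add0r addn1.
- rewrite -!catA; have [u1 D1 C1] := IH1 _ A (flat c2 ++ B) erefl.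
  have [u2 D2 C2] := IH2 _ (A ++ flat c1) B (catA _ _ _).
  exists (u1 ++ u2) => [|w]; first by rewrite all_cat D1.
  by rewrite -catA C1 -size_cat C2 !size_cat addnA.
- exists [:: 0] => // w /=; rewrite instr_at_cat next_pc_cat /= ?add0r.
    by rewrite size_cat /= addn1.
  by rewrite !size_cat /=; lia.
- set sz := size (flat c); set P' := A ++ _.
  have EP : P' = rcons A (IFork sz.+2) ++ flat c ++ (IBack sz.+1 :: B).
    by rewrite /P' -cats1 -!catA.
  have [u1 D1 C1] := IH1 _ _ _ EP.
  have [u2 D2 C2] := IH2 P' A B erefl.
  (* Letter 1 enters the body; letter 0 is spent on [IBack]. *)
  exists (1 :: u1 ++ 0 :: u2) => [|w]; first by rewrite /= all_cat D1.
  rewrite /= -catA /= -/P' /P' instr_at_cat next_pc_cat /=; last by rewrite size_cat; lia.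
  rewrite add0r -/P' -[X in cost _ X _ _](size_rcons A (IFork sz.+2)) C1 /= EP catA.
  rewrite -size_cat instr_at_cat next_pc_cat /=; last by lia.
  rewrite add0r -catA -EP size_cat size_rcons -/sz.
  have -> : (size A).+1 + sz - sz.+1 = size A by lia.
  by rewrite C2.
Qed.

(** Registers 0, 1, 2 will hold the three numbers from which a representation computes its own
    code. *)
Definition accept_cmd (q : recf) : cmd :=
  CSeq (compile q [:: 0; 1; 2] 3) (CSeq (CZero 4) (CTest 3 4)).

(* [IFork 1] does nothing, so the first [j] letters of the input are ignored. *)
Definition program (j : nat) (q : recf) : seq instr :=
  nseq j (IFork 1) ++ flat (accept_cmd q).

Lemma size_program j q : j < size (program j q).
Proof. by rewrite size_cat size_nseq /= !size_cat /=; lia. Qed.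

Lemma cost_prelude j q i rho d w : i < j ->
  cost (program j q) i rho (d :: w) = cost (program j q) i.+1 rho w.
Proof.
move=> lt /=; have -> : instr_at (program j q) i = IFork 1.
  by rewrite /instr_at nth_cat size_nseq lt nth_nseq lt.
rewrite /= add0r; congr (cost _ _ _ _); rewrite /next_pc.
have -> : instr_at (program j q) i = IFork 1.
  by rewrite /instr_at nth_cat size_nseq lt nth_nseq lt.
rewrite /= addn1 if_same; apply/minn_idPr.
by apply: leq_trans lt (ltnW (size_program _ _)).
Qed.

Lemma cost_prelude_nil j q i rho : i <= j -> cost (program j q) i rho [::] = 1%R.
Proof. by move=> le /=; rewrite neq_ltn (leq_ltn_trans le (size_program _ _)). Qed.

Lemma cost_program_sound j q rho w : cost (program j q) 0 rho w = 0%R ->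
  eval q [:: rho 0; rho 1; rho 2] 0.
Proof.
have skip i v : i <= j -> cost (program j q) i rho v = 0%R ->
    exists v', cost (program j q) j rho v' = 0%R.
  move=> le; move Em : (j - i) => m.
  elim: m i v le Em => [|m IH] i v le Em C.
    have Eij : i = j by apply/eqP; rewrite eqn_leq le -subn_eq0 Em.
    by exists v; rewrite -Eij in C *.
  case: v C => [|d v]; first by rewrite cost_prelude_nil.
  rewrite cost_prelude; last by lia.
  by apply: IH; lia.
case/(skip _ _ (leq0n j)) => v.
have {2}-> : j = size (nseq j (IFork 1)) by rewrite size_nseq.
move=> C; have EP : program j q = nseq j (IFork 1) ++ flat (accept_cmd q) ++ [::].
  by rewrite cats0.
have [rho' [_ [_ X _]]] := flat_sound EP C.
case/exec_seqE: X => r1 /compile_sound[] // E _.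
case/exec_seqE=> r2 /exec_zeroE -> /exec_testE[_].
by simpl_reg => E0; rewrite E0 in E.
Qed.

Lemma cost_program_complete j q rho : eval q [:: rho 0; rho 1; rho 2] 0 ->
  exists2 u, all (gtn 2) u & forall w, cost (program j q) 0 rho (u ++ w) = 0%R.
Proof.
move=> E; have [|rho1 X1 [E1 _]] := @compile_complete q [:: 0; 1; 2] 3 rho 0 _ E; first by [].
have X : exec (accept_cmd q) rho (set_reg rho1 4 0).
  by apply: ex_seq X1 (ex_seq (ex_zero _ _) (ex_test _)); simpl_reg.
have EP : program j q = nseq j (IFork 1) ++ flat (accept_cmd q) ++ [::].
  by rewrite cats0.
have [u D C] := flat_complete X EP.
exists (nseq j 0 ++ u) => [|w]; first by rewrite all_cat all_nseq D orbT.
have skip i : i <= j ->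
    cost (program j q) (j - i) rho ((nseq i 0 ++ u) ++ w) = cost (program j q) j rho (u ++ w).
  elim: i => [|i IH] lt; first by rewrite subn0.
  have -> : (nseq i.+1 0 ++ u) ++ w = 0 :: ((nseq i 0 ++ u) ++ w) by [].
  rewrite cost_prelude; last by lia.
  by rewrite -IH; [congr (cost _ _ _ _); lia | lia].
have := skip j (leqnn j); rewrite subnn => ->.
rewrite size_nseq in C; rewrite C.
have -> : j + size (flat (accept_cmd q)) = size (program j q).
  by rewrite [RHS]size_cat size_nseq.
exact: cost_halt.
Qed.

(** * Base-k digits *)

Lemma digits_aux_fuel k f1 f2 n : 2 <= k -> n <= f1 -> n <= f2 ->
  digits_aux k f1 n = digits_aux k f2 n.
Proof.
move=> hk; elim: f1 f2 n => [|f1 IH] [|f2] n //=.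
- by rewrite leqn0 => /eqP-> _.
- by move=> _; rewrite leqn0 => /eqP->.
- case: eqP => [-> //|/eqP n0] l1 l2; congr cons; apply: IH.
    by rewrite -ltnS; apply: leq_trans l1; apply: ltn_Pdiv; lia.
  by rewrite -ltnS; apply: leq_trans l2; apply: ltn_Pdiv; lia.
Qed.

Lemma digits0 k : digits k 0 = [::]. Proof. by []. Qed.

Lemma digits_pos k n : 2 <= k -> 0 < n -> digits k n = n %% k :: digits k (n %/ k).
Proof.
move=> hk; case: n => // n _; rewrite {1}/digits /=; congr cons.
by apply: digits_aux_fuel => //; rewrite -ltnS ltn_Pdiv.
Qed.

Lemma digits_ind k (Q : nat -> Prop) : 2 <= k ->
  Q 0 -> (forall n, 0 < n -> Q (n %/ k) -> Q n) -> forall n, Q n.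
Proof.
move=> hk Q0 QS n; have [m le] := ubnP n; elim: m => // m IH in n le *.
case: n le => // n le; apply: QS => //; apply: IH.
rewrite ltnS in le; apply: leq_trans le; exact: ltn_Pdiv.
Qed.

Lemma digits_lt k n : 2 <= k -> all (gtn k) (digits k n).
Proof.
move=> hk; move: n; apply: (digits_ind hk) => // n n0 IH.
by rewrite digits_pos //= IH ltn_mod; lia.
Qed.

(** The most significant digit 1 is added because [u] may end in zeros, which cannot be leading
    digits. *)
Lemma digits_onto k u : 2 <= k -> all (gtn k) u ->
  exists2 n, 0 < n & digits k n = rcons u 1.
Proof.
move=> hk; elim: u => [|d u IH] /=.
  by exists 1 => //; rewrite digits_pos // modn_small // divn_small.
case/andP=> lt /IH[n n0 E]; exists (n * k + d).
  by rewrite addn_gt0 muln_gt0 n0; lia.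
rewrite digits_pos ?modnMDl ?modn_small ?divnMDl ?divn_small ?addn0 ?E //; lia.
Qed.

Local Open Scope ring_scope.

(** * Linear representations over finite index types *)

(** A matrix product applied to the column [e]; with a finite type of indices, states can be pairs
    and options. *)
Fixpoint val_from (I : finType) (M : nat -> I -> I -> int) (e : I -> int)
    (w : seq nat) (i : I) : int :=
  match w with
  | [::] => e i
  | d :: w' => \sum_j M d i j * val_from M e w' j
  end.

(** The Kronecker product represents the termwise product of two sequences. *)
Lemma val_from_kron (I J : finType) (M : nat -> I -> I -> int) (e : I -> int)
    (N : nat -> J -> J -> int) (f : J -> int) w i j :
  val_from (fun d x y => M d x.1 y.1 * N d x.2 y.2) (fun x => e x.1 * f x.2) w (i, j) =
  val_from M e w i * val_from N f w j.
Proof.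
elim: w i j => //= d w IH i j; rewrite big_distrlr /= pair_big /=.
by apply: eq_bigr => -[a b] _ /=; rewrite IH; ring.
Qed.

(** The order [s] of the states is a parameter because the code of the initial vector depends on
    it. *)
Definition rep_of (I : finType) (k : nat) (s : seq I) (v : I -> int)
    (M : nat -> I -> I -> int) (e : I -> int) : linrep :=
  LinRep (size s) (map v s) (map e s)
    [seq [seq [seq M d i j | j <- s] | i <- s] | d <- iota 0 k].

Lemma rep_of_wf (I : finType) k (s : seq I) v M e : linrep_wf k (rep_of k s v M e).
Proof.
rewrite /linrep_wf /= !size_map size_iota !eqxx /=.
apply/allP => _ /mapP[d _ ->]; rewrite size_map eqxx /=.
by apply/allP => _ /mapP[i _ ->]; rewrite size_map.
Qed.

Lemma lr_seq_rep_of (I : finType) k (s : seq I) v M e n : (2 <= k)%N ->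
  perm_eq s (enum I) ->
  lr_seq k (rep_of k s v M e) n = \sum_i v i * val_from M e (digits k n) i.
Proof.
move=> hk Hs; set L := rep_of k s v M e.
have sumE (F : I -> int) (i0 : I) :
    \sum_(i < lr_dim L) F (nth i0 s i) = \sum_i F i.
  rewrite -[RHS]big_enum -(perm_big _ Hs) /= (big_nth i0) big_mkord.
  by apply: eq_bigr.
case Es : s => [|i0 s'].
  rewrite /lr_seq mxE big1; last first.
    by move=> j; exfalso; have : (nat_of_ord j < size s)%N := ltn_ord j; rewrite Es.
  by rewrite -big_enum -(perm_big _ Hs) /= Es big_nil.
have col w : all (gtn k) w -> forall i : 'I_(lr_dim L),
    (foldr (fun d P => lr_mat L d *m P) 1%:M w *m lr_col L) i ord0 =
    val_from M e w (nth i0 s i).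
  elim: w => [_|d w IH /= /andP[ltd /IH{}IH]] i.
    by rewrite /= mul1mx mxE /= (nth_map i0).
  rewrite -mulmxA mxE -(sumE _ i0); apply: eq_bigr => j _; rewrite IH mxE /=.
  rewrite (nth_map 0%N) ?size_iota // nth_iota // add0n.
  by rewrite (nth_map i0) ?(nth_map i0).
rewrite /lr_seq -mulmxA mxE -(sumE _ i0); apply: eq_bigr => j _.
by rewrite col ?digits_lt // mxE /= (nth_map i0).
Qed.

(** * The cost as a quadratic form in the registers *)

(** Homogeneous coordinates: the constant coordinate 0 makes affine steps linear. *)
Definition ext (rho : env) (a : nat) : int := if a is r.+1 then Posz (rho r) else 1.

(** The coefficient of the old coordinate [a] in the new coordinate [b]. *)
Definition act_coef (i : instr) (a b : nat) : int :=
  match i with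
  | IZero r => Posz ((b != r.+1) && (a == b))
  | IInc r => Posz (a == b) + Posz ((b == r.+1) && (a == 0%N))
  | ICopy r s => Posz (a == (if b == r.+1 then s.+1 else b))
  | _ => Posz (a == b)
  end.

Definition test_coef (i : instr) (a : nat) : int :=
  match i with
  | ITest r s => Posz (a == r.+1) - Posz (a == s.+1)
  | _ => 0
  end.

Definition max_reg (i : instr) : nat :=
  match i with
  | IZero r | IInc r => r
  | ICopy r s | ITest r s => maxn r s
  | _ => 0
  end.

Lemma sum_delta (B c : nat) (X : nat -> int) : (c < B)%N ->
  \sum_(a < B) X a * Posz (nat_of_ord a == c) = X c.
Proof.
move=> lt; rewrite (bigD1 (Ordinal lt)) //= eqxx mulr1 big1 ?addr0 // => a ne.
by rewrite (_ : (_ == c) = false) ?mulr0 //; apply/negbTE.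
Qed.

Lemma act_coefP B i rho b : (max_reg i + 1 < B)%N -> (b < B)%N ->
  \sum_(a < B) ext rho a * act_coef i a b = ext (act i rho) b.
Proof.
move=> li lb; case: i li => [r|r|r s|r s|l|l] /= li; try exact: sum_delta.
- have [->|ne] /= := eqVneq b r.+1.
    by rewrite big1 => [|a _]; rewrite ?mulr0 //= set_reg_eq.
  rewrite sum_delta //; case: b ne {lb} => //= b ne; rewrite set_reg_neq //.
- have [->|ne] /= := eqVneq b r.+1.
    under eq_bigr => a _ do rewrite mulrDr.
    rewrite big_split /= !sum_delta //=; try lia.
    by rewrite set_reg_eq; lia.
  under eq_bigr => a _ do rewrite addr0.
  by rewrite sum_delta //; case: b ne {lb} => //= b ne; rewrite set_reg_neq.
- case: eqVneq => [->|ne] /=; rewrite sum_delta //=; try lia.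
    by rewrite set_reg_eq.
  by case: b ne {lb} => //= b ne; rewrite set_reg_neq.
Qed.

Lemma test_coefP B i rho : (max_reg i + 1 < B)%N ->
  (\sum_(a < B) ext rho a * test_coef i a) ^+ 2 = defect i rho.
Proof.
move=> li; case: i li => [r|r|r s|r s|l|l] /= li;
  try by rewrite big1 ?expr0n // => a _; rewrite mulr0.
under eq_bigr => a _ do rewrite mulrBr.
by rewrite big_split /= sumrN !sum_delta //=; lia.
Qed.

(* [Some (pc, (a, b))] carries the coefficient of [ext rho a * ext rho b] in the cost of a run started at address [pc]; [None] carries the constant 1. *)
Definition qindex (N B : nat) : finType := option ('I_N * ('I_B * 'I_B)).

Definition qmat (P : seq instr) (B : nat) (d : nat)
    (x y : qindex (size P).+1 B) : int :=
  match x, y with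
  | None, None => 1
  | None, Some _ => 0
  | Some (pc, (a, b)), None =>
      test_coef (instr_at P pc) a * test_coef (instr_at P pc) b
  | Some (pc, (a, b)), Some (pc', (a', b')) =>
      Posz (nat_of_ord pc' == next_pc P pc d) *
      (act_coef (instr_at P pc) a a' * act_coef (instr_at P pc) b b')
  end.

(** The cost 1 of not having halted is attached to the pair (0, 0), whose monomial is 1. *)
Definition qfin (P : seq instr) (B : nat) (x : qindex (size P).+1 B) : int :=
  match x with
  | None => 1
  | Some (pc, (a, b)) =>
      Posz (nat_of_ord pc != size P) *
      (Posz (nat_of_ord a == 0%N) * Posz (nat_of_ord b == 0%N))
  end.

Lemma sum_option (T : finType) (F : option T -> int) :
  \sum_x F x = F None + \sum_x F (Some x).
Proof.
rewrite (bigD1 None) //=; congr (_ + _).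
rewrite (reindex_omap Some id) /=; last by case.
by apply: eq_bigl => x; rewrite eqxx.
Qed.

Lemma val_from_qNone P B w : val_from (@qmat P B) (@qfin P B) w None = 1.
Proof.
elim: w => //= d w IH; rewrite sum_option IH mulr1 big1 ?addr0 // => x _.
by rewrite mul0r.
Qed.

(** A defect is the square of a linear form, and substituting the linear step into the quadratic
    form of the remaining word gives a quadratic form again. *)
Lemma cost_quadratic P B rho w (pc : 'I_(size P).+1) :
  (0 < B)%N -> (forall q, max_reg (instr_at P q) + 1 < B)%N ->
  cost P pc rho w =
  \sum_(a < B) \sum_(b < B) ext rho a * ext rho b *
     val_from (@qmat P B) (@qfin P B) w (Some (pc, (a, b))).
Proof.
move=> B0 HB; elim: w pc rho => [|d w IH] pc rho.
  transitivity (Posz (pc != size P :> nat) *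
    ((\sum_(a < B) ext rho a * Posz (nat_of_ord a == 0%N)) *
     (\sum_(b < B) ext rho b * Posz (nat_of_ord b == 0%N)))).
    by rewrite !sum_delta //= !mulr1.
  rewrite big_distrlr /= mulr_sumr; apply: eq_bigr => a _.
  by rewrite mulr_sumr; apply: eq_bigr => b _ /=; ring.
have ltn : (next_pc P pc d < (size P).+1)%N by rewrite ltnS geq_minl.
pose i := instr_at P pc.
have stepE a b : val_from (@qmat P B) (@qfin P B) (d :: w) (Some (pc, (a, b))) =
    test_coef i a * test_coef i b +
    \sum_(x < B) \sum_(y < B) act_coef i a x * act_coef i b y *
       val_from (@qmat P B) (@qfin P B) w (Some (Ordinal ltn, (x, y))).
  rewrite /= sum_option val_from_qNone mulr1; congr (_ + _).
  transitivity (\sum_(p < (size P).+1) \sum_(xy : 'I_B * 'I_B)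
     @qmat P B d (Some (pc, (a, b))) (Some (p, xy)) *
     val_from (@qmat P B) (@qfin P B) w (Some (p, xy))).
    by rewrite pair_bigA; apply: eq_bigr => -[p xy].
  rewrite (bigD1 (Ordinal ltn)) //= [X in _ + X]big1 ?addr0 => [|p ne].
    rewrite pair_bigA /=; apply: eq_bigr => -[x y] _ /=.
    by rewrite eqxx mul1r.
  rewrite big1 // => -[x y] _ /=.
  by rewrite (_ : (_ == next_pc _ _ _) = false) ?mul0r //; apply/negbTE.
rewrite [LHS]/=.
under eq_bigr => a _ do under eq_bigr => b _ do rewrite stepE mulrDr.
under eq_bigr => a _ do rewrite big_split /=.
rewrite big_split /=; congr (_ + _).
  rewrite -(test_coefP rho (HB pc)) expr2 big_distrlr /=.
  by apply: eq_bigr => a _; apply: eq_bigr => b _; rewrite /i; ring.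
rewrite -[next_pc P pc d]/(nat_of_ord (Ordinal ltn)) IH.
transitivity (\sum_(x < B) \sum_(y < B) \sum_(a < B) \sum_(b < B)
  ext rho a * ext rho b * (act_coef i a x * act_coef i b y *
       val_from (@qmat P B) (@qfin P B) w (Some (Ordinal ltn, (x, y))))).
  apply: eq_bigr => x _; apply: eq_bigr => y _.
  rewrite -(act_coefP rho (HB pc) (ltn_ord x)) -(act_coefP rho (HB pc) (ltn_ord y)).
  rewrite big_distrlr /= mulr_suml; apply: eq_bigr => a _.
  by rewrite mulr_suml; apply: eq_bigr => b _; rewrite -/i; ring.
rewrite pair_bigA /= [RHS]pair_bigA /=.
under eq_bigr => p _ do rewrite pair_bigA /=.
rewrite exchange_big /=; apply: eq_bigr => -[a b] _ /=.
by rewrite pair_bigA /= mulr_sumr.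
Qed.

(** * Powers in signed block sequences *)

Definition sgn_mod (k n : nat) : int := if (k %| n)%N then -1 else 1.

(** The other factors are positive, so signs and absolute values agree separately. *)
Lemma signed_eq k (g : nat -> int) a b : (forall n, 0 < g n) ->
  sgn_mod k a * Posz a.+1 * g a = sgn_mod k b * Posz b.+1 * g b ->
  (k %| a)%N = (k %| b)%N /\ Posz a.+1 * g a = Posz b.+1 * g b.
Proof.
move=> g0; have pos n : 0 < Posz n.+1 * g n by rewrite mulr_gt0.
have := pos a; have := pos b; rewrite /sgn_mod.
case: (k %| a)%N; case: (k %| b)%N; rewrite ?mulN1r ?mul1r ?mulNr; lia.
Qed.

(* If k does not divide m, the signs show that no multiple of k lies in the square, so its two halves start in the same block of length K; if k divides m, two neighbours in a common block give [g] equal on both halves. *)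
Lemma signed_blocks_no_power (k K alpha : nat) (g f : nat -> int) :
  (2 <= alpha)%N -> (2 <= k)%N -> (4 <= K)%N -> (k %| K)%N ->
  (forall n, 0 < g n) ->
  (forall a b, (a %/ K = b %/ K)%N -> g a = g b) ->
  (forall n, f n = sgn_mod k n * Posz n.+1 * g n) ->
  ~ has_power f alpha.
Proof.
move=> ha hk hK kK g0 gK fE [i [m [m1 H]]].
have eqf t : (t < m)%N -> (k %| i + t)%N = (k %| i + t + m)%N /\
    Posz (i + t).+1 * g (i + t)%N = Posz (i + t + m).+1 * g (i + t + m)%N.
  move=> lt; apply: signed_eq => //; rewrite -!fE.
  by have := H 1%N t ha lt; rewrite mul1n => ->; congr f; lia.
(* Cancelling equal values of [g] would force [m = 0]. *)
have distinct t : (t < m)%N -> g (i + t)%N <> g (i + t + m)%N.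
  move=> lt E; have [_] := eqf t lt; rewrite E => /mulIf.
  by move/(_ (lt0r_neq0 (g0 _))); lia.
have dvd_m t : (t < m)%N -> (k %| i + t)%N -> (k %| m)%N.
  by move=> lt d; have [/esym] := eqf t lt; rewrite d dvdn_addr.
have gS a : ~~ (k %| a.+1)%N -> g a.+1 = g a.
  move=> nd; apply: gK; rewrite divnS; last by lia.
  by rewrite (contraNF (dvdn_trans kK)).
have gSK a : ~~ (K %| a.+1)%N -> g a.+1 = g a.
  by move=> nd; apply: gK; rewrite divnS ?(negbTE nd); lia.
have km : (k %| m)%N.
  apply/negPn/negP => nkm; apply: (distinct 0%N) => //.
  rewrite addn0; have nd t : (0 < t <= m)%N -> ~~ (k %| i + t)%N.
    case/andP=> t0 tm; apply/negP => d; move/negP: nkm; apply.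
    move: tm; rewrite leq_eqVlt => /orP[/eqP Et|lt]; last exact: dvd_m d.
    (* For [t = m], the signs at [i + m] and [i] agree, which leads back to [t = 0]. *)
    have [E _] := eqf 0%N m1.
    by apply: (dvd_m 0%N) => //; rewrite E addn0 -Et.
  have same t : (t <= m)%N -> g (i + t)%N = g i.
    elim: t => [|t IH] lt; first by rewrite addn0.
    by rewrite addnS gS -?addnS ?nd // IH // ltnW.
  by rewrite same.
have m2 : (2 <= m)%N by apply: leq_trans hk _; exact: dvdn_leq.
(* Subtracting the equations at [t] and [t.+1] leaves [g (i + t) = g (i + t + m)]. *)
have pair t : (t.+1 < m)%N -> ~~ (k %| (i + t).+1)%N -> False.
  move=> lt nd; have [_ E0] := eqf t (ltnW lt); have [_ E1] := eqf _ lt.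
  apply: (distinct t); first exact: ltnW.
  have nd' : ~~ (k %| (i + t + m).+1)%N by rewrite -addSn dvdn_addl.
  have G1 := gS _ nd; have G2 := gS _ nd'.
  move: E1; rewrite !addnS !addSn G1 G2 => E1.
  move: E1; rewrite (intS (i + t).+1) (intS (i + t + m).+1) !mulrDl E0 => /addIr.
  by rewrite !mul1r.
have step a : (k %| a.+1)%N -> ~~ (k %| a.+2)%N.
  move=> d; apply/negP; rewrite -addn1 dvdn_addr // => /dvdn_leq; lia.
case: (boolP (k %| i.+1)%N) => [d|nd]; last by apply: (pair 0%N); rewrite ?addn0.
case: (ltnP 2 m) => [m3|m2'].
  by apply: (pair 1%N) => //; rewrite addn1; exact: step.
(* The only pair in a half straddles a multiple of [k]. Either [i.+1] starts a block, which by
   [K >= 4] contains [i.+3], or [i], [i.+1] and [i.+2] share a block; both contradict [distinct]. *)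
have Em : m = 2 by apply/eqP; rewrite eqn_leq m2' m2.
case: (boolP (K %| i.+1)%N) => [dK|ndK].
  have ndvd r : (0 < r < 4)%N -> ~~ (K %| (i + r).+1)%N.
    move=> lr; apply/negP; rewrite -addSn dvdn_addr // => /dvdn_leq; lia.
  apply: (distinct 1%N) => //; rewrite Em !addnS !addn0.
  rewrite (gSK i.+2); last by have := ndvd 2 isT; rewrite !addnS addn0.
  by rewrite (gSK i.+1) //; have := ndvd 1%N isT; rewrite !addnS addn0.
apply: (distinct 0%N) => //; rewrite Em !addnS !addn0.
by rewrite (gS i.+1) ?step // gSK.
Qed.

Lemma has_power_zero_block K alpha q (f : nat -> int) : (alpha <= K)%N ->
  (forall n, (n %/ K = q)%N -> f n = 0) -> has_power f alpha.
Proof.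
case: alpha => [|alpha] le H; first by exists 0%N, 1%N.
exists (q * K)%N, 1%N; split=> // s t ls; rewrite ltnS leqn0 => /eqP->.
rewrite !H //.
  by rewrite muln1 addn0 divnMDl ?divn_small ?addn0 //; lia.
by rewrite addn0 mulnK //; lia.
Qed.

(** * The representation of the signed cost sequence *)

(* The states [None], [Some false], [Some true] carry 1, n, and [sgn_mod k n * (n + 1)]. *)
Definition sign_mat (k d : nat) (x y : option bool) : int :=
  match x, y with
  | None, None => 1
  | Some false, None => Posz d
  | Some false, Some false => Posz k
  | Some true, None => sgn_mod k d * Posz d.+1
  | Some true, Some false => sgn_mod k d * Posz k
  | _, _ => 0
  end.

(** These are the values at [n = 0]; the last is -1 because [k] divides 0. *)
Definition sign_fin (x : option bool) : int :=
  match x with None => 1 | Some false => 0 | Some true => -1 end.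

Lemma sum_option_bool (F : option bool -> int) :
  \sum_x F x = F None + (F (Some true) + F (Some false)).
Proof. by rewrite sum_option big_bool. Qed.

Lemma val_from_sign k n : (2 <= k)%N ->
  [/\ val_from (sign_mat k) sign_fin (digits k n) None = 1,
      val_from (sign_mat k) sign_fin (digits k n) (Some false) = Posz n &
      val_from (sign_mat k) sign_fin (digits k n) (Some true) =
        sgn_mod k n * Posz n.+1].
Proof.
move=> hk; move: n; apply: (digits_ind hk) => [|n n0 [E1 E2 _]].
  by rewrite digits0 /= /sgn_mod dvdn0.
rewrite digits_pos //= !sum_option_bool /= E1 E2.
have En : Posz n = Posz (n %% k) + Posz k * Posz (n %/ k).
  by rewrite {1}(divn_eq n k); lia.
have -> : sgn_mod k n = sgn_mod k (n %% k) by rewrite /sgn_mod /dvdn modn_mod.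
by split; rewrite -?[n.+1]addn1 ?PoszD ?En; ring.
Qed.

(** This leaves room for the index shift of [ext] and always contains the coordinates 0 to 3 of the
    constant and the inputs. *)
Definition reg_bound (P : seq instr) : nat := (\max_(q < size P) max_reg (instr_at P q)).+4.

Lemma reg_boundP P q : (max_reg (instr_at P q) + 1 < reg_bound P)%N.
Proof.
have : (max_reg (instr_at P q) <= \max_(q < size P) max_reg (instr_at P q))%N.
  case: (ltnP q (size P)) => lt; last by rewrite /instr_at nth_default.
  exact: (leq_bigmax (Ordinal lt) (F := fun i : 'I_(size P) => max_reg (instr_at P i))).
by rewrite /reg_bound; lia.
Qed.

Definition rep_index (P : seq instr) : finType :=
  (option bool * qindex (size P).+1 (reg_bound P))%type.

Definition rep_mat (k : nat) (P : seq instr) (d : nat) (x y : rep_index P) : int :=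
  sign_mat k d x.1 y.1 * qmat d x.2 y.2.

Definition rep_fin (P : seq instr) (x : rep_index P) : int :=
  sign_fin x.1 * qfin x.2.

(** [Some true] selects the signed factor, and address 0 the start of the run. *)
Definition rep_init (P : seq instr) (rho : env) (x : rep_index P) : int :=
  match x with
  | (Some true, Some (pc, (a, b))) =>
      if nat_of_ord pc is 0 then ext rho a * ext rho b else 0
  | _ => 0
  end.

Definition small_regs (P : seq instr) : seq 'I_(reg_bound P) :=
  [:: @Ordinal (reg_bound P) 0 isT; @Ordinal (reg_bound P) 1 isT;
      @Ordinal (reg_bound P) 2 isT; @Ordinal (reg_bound P) 3 isT].

Definition init_indices (P : seq instr) : seq (rep_index P) :=
  [seq (Some true, Some (ord0, (a, b))) | a <- small_regs P, b <- small_regs P].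

(* Listing the input-dependent entries first leaves a tail of the initial vector that does not depend on the input. *)
Definition rep_enum (P : seq instr) : seq (rep_index P) :=
  init_indices P ++ [seq x <- enum (rep_index P) | x \notin init_indices P].

Definition rep (k : nat) (P : seq instr) (rho : env) : linrep :=
  rep_of k (rep_enum P) (@rep_init P rho) (@rep_mat k P) (@rep_fin P).

Lemma init_indices_uniq P : uniq (init_indices P).
Proof. by []. Qed.

Lemma rep_enum_perm P : perm_eq (rep_enum P) (enum (rep_index P)).
Proof.
apply: uniq_perm; [|exact: enum_uniq|].
  rewrite cat_uniq init_indices_uniq filter_uniq ?enum_uniq ?andbT //=.
  by apply/hasPn => x; rewrite mem_filter => /andP[].
by move=> x; rewrite mem_cat mem_filter mem_enum andbT orbN.
Qed.

Lemma mem_small_regs P (a : 'I_(reg_bound P)) : (a < 4)%N -> a \in small_regs P.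
Proof.
move=> lt; rewrite !inE -!val_eqE /=.
by case: (nat_of_ord a) lt => [|[|[|[|]]]].
Qed.

(** Registers from 3 on start at 0, so all other monomials vanish. *)
Lemma rep_init_tail P (d e r : nat) (x : rep_index P) : x \notin init_indices P ->
  rep_init (nth 0%N [:: d; e; r]) x = 0.
Proof.
case: x => [[[]|] [[pc [a b]]|]] //= nx.
case Epc : (nat_of_ord pc) => [|//].
have {Epc}Epc : pc = ord0 by exact/val_inj.
case: (ltnP a 4) => [lta|].
  case: (ltnP b 4) => [ltb|].
    case/negP: nx; rewrite Epc.
    by apply: (allpairs_f (fun a b => (Some true, Some (ord0, (a, b)))));
      exact: mem_small_regs.
  by case: (nat_of_ord b) => [|[|[|[|n]]]] //= _; rewrite nth_nil mulr0.
by case: (nat_of_ord a) => [|[|[|[|n]]]] //= _; rewrite nth_nil mul0r.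
Qed.

Lemma lr_seq_rep k P rho n : (2 <= k)%N ->
  lr_seq k (rep k P rho) n =
  sgn_mod k n * Posz n.+1 * cost P 0 rho (digits k n).
Proof.
move=> hk; rewrite /rep lr_seq_rep_of ?rep_enum_perm //.
have [_ _ <-] := val_from_sign n hk.
have -> : 0%N = @ord0 (size P) :> nat by [].
rewrite (cost_quadratic rho _ _ (isT : (0 < reg_bound P)%N) (reg_boundP P)).
set u := val_from (sign_mat k) _ _; set z := val_from (@qmat P _) _ _.
transitivity (\sum_(c : option bool) \sum_(y : qindex (size P).+1 (reg_bound P))
    @rep_init P rho (c, y) * (u c * z y)).
  rewrite pair_bigA; apply: eq_bigr => -[c y] _ /=.
  by rewrite -val_from_kron.
rewrite sum_option_bool big1 ?add0r => [|y _]; last by rewrite mul0r.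
rewrite [X in _ + X]big1 ?addr0 => [|y _]; last by rewrite mul0r.
rewrite sum_option /= mul0r add0r pair_bigA mulr_sumr /=.
transitivity (\sum_(pc < (size P).+1) \sum_(ab : 'I_(reg_bound P) * 'I_(reg_bound P))
    @rep_init P rho (Some true, Some (pc, ab)) * (u (Some true) * z (Some (pc, ab)))).
  by rewrite pair_bigA; apply: eq_bigr => -[pc ab].
rewrite (bigD1 ord0) //= [X in _ + X]big1 ?addr0 => [|pc ne].
  by apply: eq_bigr => -[a b] _ /=; ring.
rewrite big1 // => -[a b] _ /=.
case Epc : (nat_of_ord pc) => [|m]; last by rewrite mul0r.
by case/eqP: ne; exact/val_inj.
Qed.

(** Each prelude instruction discards one digit. If the digits run out first, both sides are 1. *)
Lemma cost_digits_block j q rho k n : (2 <= k)%N ->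
  cost (program j q) 0 rho (digits k n) =
  cost (program j q) j rho (digits k (n %/ k ^ j)).
Proof.
move=> hk; suff H i m : (i <= j)%N -> cost (program j q) (j - i) rho (digits k m) =
    cost (program j q) j rho (digits k (m %/ k ^ i)) by rewrite -H // subnn.
elim: i m => [|i IH] m le; first by rewrite subn0 expn0 divn1.
rewrite expnS divnMA; case: (posnP m) => [->|m0].
  by rewrite !div0n digits0 !cost_prelude_nil // leq_subr.
rewrite (digits_pos hk m0) cost_prelude; last by lia.
by rewrite -IH ?(ltnW le) //; congr (cost _ _ _ _); lia.
Qed.

(** * A recursive function computing the code of a representation *)

Definition computes (p : recf) (F : seq nat -> nat) := forall xs, eval p xs (F xs).

Lemma computes_proj i : computes (RProj i) (fun xs => nth 0%N xs i).
Proof. by move=> xs; exact: ev_proj. Qed.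

Lemma computes_succ g G : computes g G ->
  computes (RComp RSucc [:: g]) (fun xs => (G xs).+1).
Proof.
move=> Hg xs; apply: ev_comp (ev_succ [:: G xs]).
exact: evs_cons (Hg xs) (evs_nil _).
Qed.

Definition binary (p : recf) (op : nat -> nat -> nat) :=
  forall a b, eval p [:: a; b] (op a b).

Lemma computes_binary p op g G h H : binary p op -> computes g G -> computes h H ->
  computes (RComp p [:: g; h]) (fun xs => op (G xs) (H xs)).
Proof.
move=> Hp Hg Hh xs; apply: ev_comp (Hp _ _).
exact: evs_cons (Hg xs) (evs_cons (Hh xs) (evs_nil _)).
Qed.

Definition Radd : recf := RPrim (RProj 0) (RComp RSucc [:: RProj 1]).

Lemma Radd_binary : binary Radd addn.
Proof.
move=> a b; elim: a => [|a IH]; first exact/ev_prim0/(@computes_proj 0).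
exact: ev_primS IH (computes_succ (@computes_proj 1) _).
Qed.

Definition Rmul : recf := RPrim RZero (RComp Radd [:: RProj 2; RProj 1]).

Lemma Rmul_binary : binary Rmul muln.
Proof.
move=> a b; elim: a => [|a IH]; first exact/ev_prim0/ev_zero.
rewrite mulSn; apply: ev_primS IH _.
exact: (computes_binary Radd_binary (@computes_proj 2) (@computes_proj 1)).
Qed.

(** The halving in [npair] becomes a sum, as consecutive triangular numbers differ by [n.+1]. *)
Definition Rtri : recf :=
  RPrim RZero (RComp Radd [:: RProj 1; RComp RSucc [:: RProj 0]]).

Lemma Rtri_unary g G : computes g G ->
  computes (RComp Rtri [:: g]) (fun xs => (G xs * (G xs).+1) %/ 2)%N.
Proof.
move=> Hg xs; apply: ev_comp; first exact: evs_cons (Hg xs) (evs_nil _).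
elim: (G xs) => [|n IH]; first exact/ev_prim0/ev_zero.
have -> : (n.+1 * n.+2 %/ 2 = (n * n.+1) %/ 2 + n.+1)%N.
  rewrite -divnDMl //; congr (_ %/ 2)%N; lia.
apply: ev_primS IH _.
exact: (computes_binary Radd_binary (@computes_proj 1)
         (computes_succ (@computes_proj 0))).
Qed.

Definition Rpair : recf :=
  RComp Radd [:: RComp Rtri [:: RComp Radd [:: RProj 0; RProj 1]]; RProj 1].

Lemma Rpair_binary : binary Rpair npair.
Proof.
move=> a b.
have Ht := Rtri_unary (computes_binary Radd_binary (@computes_proj 0) (@computes_proj 1)).
exact: (computes_binary Radd_binary Ht (@computes_proj 1) [:: a; b]).
Qed.

(** The open tail [t] lets computed entries be followed by a given code. *)
Definition Renc (gs : seq recf) (t : recf) : recf :=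
  foldr (fun g h => RComp RSucc [:: RComp Rpair [:: g; h]]) t gs.

Lemma computes_enc (T : Type) (s : seq T) (g : T -> recf) (G : T -> seq nat -> nat) t H :
  (forall x, computes (g x) (G x)) -> computes t H ->
  computes (Renc (map g s) t)
    (fun xs => foldr (fun x h => (npair (G x xs) h).+1) (H xs) s).
Proof.
move=> Hg Ht; elim: s => //= x s IH.
exact: computes_succ (computes_binary Rpair_binary (Hg x) IH).
Qed.

Definition Rext (a : nat) : recf := if a is r.+1 then RProj r else RComp RSucc [:: RZero].

Definition extn (xs : seq nat) (a : nat) : nat := if a is r.+1 then nth 0%N xs r else 1%N.

Lemma computes_ext a : computes (Rext a) (fun xs => extn xs a).
Proof.
case: a => [|r] /=; last exact: computes_proj.
by apply: (@computes_succ _ (fun=> 0%N)) => xs; exact: ev_zero.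
Qed.

(** The factor 2 is that of [enc_int] on nonnegative integers. *)
Definition Rentry (ab : nat * nat) : recf :=
  RComp Rmul [:: RComp RSucc [:: RComp RSucc [:: RZero]];
                 RComp Rmul [:: Rext ab.1; Rext ab.2]].

Lemma computes_entry ab :
  computes (Rentry ab) (fun xs => 2 * (extn xs ab.1 * extn xs ab.2))%N.
Proof.
apply: (@computes_binary _ _ _ (fun=> 2%N)); first exact: Rmul_binary.
  apply: (@computes_succ _ (fun=> 1%N)); apply: (@computes_succ _ (fun=> 0%N)) => xs.
  exact: ev_zero.
exact: computes_binary Rmul_binary (computes_ext _) (computes_ext _).
Qed.

Definition init_pairs : seq (nat * nat) :=
  [seq (a, b) | a <- iota 0 4, b <- iota 0 4].

(** The arguments are the dimension, the code of the zero tail of the initial vector, and the code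
    of the final vector and matrices; only the 16 leading entries are computed. *)
Definition Rquote : recf :=
  Renc [:: RProj 0; Renc (map Rentry init_pairs) (RProj 1)] (RProj 2).

Definition init_regs (xs : seq nat) : env := nth 0%N xs.

Definition rep_tail_code (P : seq instr) : nat :=
  enc_ints (nseq (size (rep_enum P) - 16) 0).

(** The matrices do not depend on the registers, so the zero environment serves and no circularity
    arises. *)
Definition rep_rest_code (k : nat) (P : seq instr) : nat :=
  enc_list [:: enc_ints (map (@rep_fin P) (rep_enum P));
               enc_list (map enc_mat (lr_M (rep k P (init_regs [::]))))].

Definition self_input (k : nat) (P : seq instr) : seq nat :=
  [:: size (rep_enum P); rep_tail_code P; rep_rest_code k P].

Lemma rep_init_vector P d e r :
  map (@rep_init P (init_regs [:: d; e; r])) (rep_enum P) =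
  [seq Posz (extn [:: d; e; r] ab.1 * extn [:: d; e; r] ab.2) | ab <- init_pairs] ++
  nseq (size (rep_enum P) - 16) 0.
Proof.
rewrite map_cat; congr (_ ++ _).
rewrite size_cat (_ : size (init_indices P) = 16%N) // addKn.
set t := [seq x <- _ | _]; rewrite -(size_map (@rep_init P (init_regs [:: d; e; r])) t).
apply/all_pred1P/allP => _ /mapP[x Hx ->]; apply/eqP; apply: rep_init_tail.
by move: Hx; rewrite mem_filter => /andP[].
Qed.

Lemma enc_list_cat s t :
  enc_list (s ++ t) = foldr (fun x h => (npair x h).+1) (enc_list t) s.
Proof. by elim: s => //= x s ->. Qed.

(** The fixed point: the arguments of [Rquote] are also the initial registers of the representation
    whose code it returns. *)
Lemma Rquote_spec k P :
  eval Rquote (self_input k P) (enc_linrep (rep k P (init_regs (self_input k P)))).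
Proof.
have He := computes_enc init_pairs computes_entry (@computes_proj 1).
have := computes_succ (computes_binary Rpair_binary (@computes_proj 0)
  (computes_succ (computes_binary Rpair_binary He (@computes_proj 2)))).
move/(_ (self_input k P)); congr (eval _ _ _).
rewrite /enc_linrep /rep /rep_of /lr_dim /lr_v /lr_w /lr_M.
rewrite /self_input rep_init_vector /enc_ints map_cat enc_list_cat.
rewrite -map_comp foldr_map.
by [].
Qed.

(** * Reduction and diagonal argument *)

(** If the evaluation to 0 is refuted, all costs are positive and there is no power; constructively
    this gives a double negation, enough for a contradiction. *)
Lemma rep_power_iff (k alpha : nat) (q : recf) (d e r : nat) :
  (2 <= k)%N -> (2 <= alpha)%N ->
  let L := rep k (program alpha q) (init_regs [:: d; e; r]) in
  (eval q [:: d; e; r] 0 -> has_power (lr_seq k L) alpha) /\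
  (has_power (lr_seq k L) alpha -> ~ ~ eval q [:: d; e; r] 0).
Proof.
move=> hk ha; set rho := init_regs _; set P := program alpha q => L.
have blk a b : (a %/ k ^ alpha = b %/ k ^ alpha)%N ->
    cost P 0 rho (digits k a) = cost P 0 rho (digits k b).
  by move=> E; rewrite !cost_digits_block // E.
have fE n : lr_seq k L n = sgn_mod k n * Posz n.+1 * cost P 0 rho (digits k n).
  exact: lr_seq_rep.
have le_exp : (alpha <= k ^ alpha)%N by apply: ltnW; exact: ltn_expl.
split=> [E|].
  have [u D C] := cost_program_complete alpha (rho := rho) E.
  have [n n0 En] := digits_onto hk (sub_all (fun x lt => leq_trans lt hk) D).
  apply: (has_power_zero_block (q := n %/ k ^ alpha) le_exp) => m Em.
  (* [C] allows any continuation, so the added digit 1 is harmless. *)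
  by rewrite fE (blk _ n) // En -cats1 C mulr0.
move=> Hp NE; move: Hp; apply: (signed_blocks_no_power ha hk _ _ _ blk fE).
- by apply: leq_trans (_ : 2 ^ 2 <= _)%N => //; apply: leq_trans (leq_pexp2l _ ha);
    rewrite ?leq_exp2r //; lia.
- by rewrite -[alpha]prednK ?expnS ?dvdn_mulr //; lia.
- move=> n; rewrite lt0r cost_ge0 andbT; apply/eqP => /cost_program_sound.
  exact: NE.
Qed.

Local Close Scope ring_scope.

Theorem theorem5p1 (k alpha : nat) (hk : (2 <= k)%N) (halpha : (2 <= alpha)%N) :
  ~ exists p : recf,
      forall L : linrep, linrep_wf k L ->
        (has_power (lr_seq k L) alpha -> eval p [:: enc_linrep L] 1%N) /\
        (~ has_power (lr_seq k L) alpha -> eval p [:: enc_linrep L] 0%N).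
Proof.
(* On [xs], [q] asks the procedure about the very representation that simulates [q] on [xs]. *)
case=> p Hp; pose q := RComp p [:: Rquote]; pose P := program alpha q.
pose xs := self_input k P; pose L := rep k P (init_regs xs).
have [yes no] := Hp L (rep_of_wf _ _ _ _ _).
have [pow_of_eval eval_of_pow] := @rep_power_iff k alpha q (size (rep_enum P))
  (rep_tail_code P) (rep_rest_code k P) hk halpha.
have quote y : eval p [:: enc_linrep L] y -> eval q xs y.
  by apply: ev_comp; exact: evs_cons (Rquote_spec k P) (evs_nil _).
have npow : ~ has_power (lr_seq k L) alpha.
  move=> pow; apply: (eval_of_pow pow) => ev0.
  by have := eval_functional ev0 (quote _ (yes pow)).
exact/npow/pow_of_eval/quote/no.
Qed.
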